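(* Consider equations $u_t+uu_x+\beta(t)u_{xxxxx}=0$. For each of the following choices of $\beta$ and of a one-dimensional Lie symmetry algebra of the corresponding equation, the functions $u$ invariant with respect to this algebra have the form of the listed ansatz with the listed invariant variable $\omega$, and such a function $u$ solves the equation if and only if $\varphi=\varphi(\omega)$ satisfies the listed ordinary differential equation (primes denote derivatives with respect to $\omega$). Here $a$ is an arbitrary real constant. Case 0. $\beta$ arbitrary, $\langle(t+a)\partial_x+\partial_u\rangle$: $\ \omega=t$, $\ u=\varphi(\omega)+\dfrac{x}{t+a}$, $\ (\omega+a)\varphi'+\varphi=0$. Case $1_{\rho\neq-1,4}$. $\beta=t^\rho$ ($\rho\neq-1,4$), $\langle5t\partial_t+(\rho+1)x\partial_x+(\rho-4)u\partial_u\rangle$: $\ \omega=xt^{-\frac{\rho+1}5}$, $\ u=t^{\frac{\rho-4}5}\varphi(\omega)$, $\ \varphi'''''+\left(\varphi-\frac{\rho+1}5\omega\right)\varphi'+\frac{\rho-4}5\varphi=0$. Case $1_{\rho=-1}$. $\beta=t^{-1}$, $\langle t\partial_t+a\partial_x-u\partial_u\rangle$: $\ \omega=x-a\ln t$, $\ u=t^{-1}\varphi(\omega)$, $\ \varphi'''''+(\varphi-a)\varphi'-\varphi=0$. Case 2. $\beta=e^t$, $\langle5\partial_t+x\partial_x+u\partial_u\rangle$: $\ \omega=xe^{-t/5}$, $\ u=e^{t/5}\varphi(\omega)$, $\ \varphi'''''+\left(\varphi-\frac15\omega\right)\varphi'+\frac15\varphi=0$. Case 3. $\beta=(t^2+1)^{3/2}e^{5\nu\arctan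 t}$, $\langle(t^2+1)\partial_t+(t+\nu)x\partial_x+(x+(\nu-t)u)\partial_u\rangle$: $\ \omega=\dfrac{xe^{-\nu\arctan t}}{\sqrt{t^2+1}}$, $\ u=\dfrac{e^{\nu\arctan t}}{\sqrt{t^2+1}}\varphi(\omega)+\dfrac{xt}{t^2+1}$, $\ \varphi'''''+(\varphi-\nu\omega)\varphi'+\nu\varphi+\omega=0$. Case 4.1. $\beta=1$, $\langle\partial_t\rangle$: $\ \omega=x$, $\ u=\varphi(\omega)$, $\ \varphi'''''+\varphi\varphi'=0$. Case 4.2. $\beta=1$, $\langle\mp\partial_t+t\partial_x+\partial_u\rangle$: $\ \omega=x\pm\dfrac{t^2}2$, $\ u=\varphi(\omega)\mp t$, $\ \varphi'''''+\varphi\varphi'\mp1=0$ (upper signs correspond to upper signs, lower to lower).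
   Context: A function $u(t,x)$ is invariant with respect to $\langle Q\rangle$, $Q=\tau\partial_t+\xi\partial_x+\eta\partial_u$, if it satisfies the invariant surface condition $\tau u_t+\xi u_x=\eta$. All considerations are local, on domains where the expressions are defined (e.g. $t>0$ in Cases 1, $t+a\neq0$ in Case 0). $\rho,\nu$ are real constants. *)

(* Defs.v *)
From Stdlib Require Export Reals.
From Coquelicot Require Export Coquelicot.
Open Scope R_scope.

(* J i j is the jet coordinate standing for the derivative of u taken i times
   in t and j times in x; in particular J 0 0 stands for u itself. *)
Definition jet_fun : Type := R -> R -> (nat -> nat -> R) -> R.

Definition jet_of (u : R -> R -> R) (t x : R) : nat -> nat -> R :=
  fun i j => Derive_n (fun s => Derive_n (u s) j x) i t.

Definition equation (beta : R -> R) : jet_fun := fun t x J =>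
  J 1%nat 0%nat + J 0%nat 0%nat * J 0%nat 1%nat + beta t * J 0%nat 5%nat.

(* tau d/dt + xi d/dx + eta d/du; the coefficients are functions of (t, x, u). *)
Record vector_field := VectorField {
  tau : R -> R -> R -> R;
  xi  : R -> R -> R -> R;
  eta : R -> R -> R -> R }.

Definition lift0 (c : R -> R -> R -> R) : jet_fun :=
  fun t x J => c t x (J 0%nat 0%nat).

(* Total derivatives, as derivatives along the direction in which t (resp. x)
   has velocity 1 and each J i j has velocity J (i+1) j (resp. J i (j+1)):
   D_t F = F_t + sum_(i,j) J (i+1) j * F_(J i j), and likewise for D_x. *)
Definition total_t (F : jet_fun) : jet_fun := fun t x J =>
  Derive (fun s => F (t + s) x (fun i j => J i j + s * J (S i) j)) 0.

Definition total_x (F : jet_fun) : jet_fun := fun t x J =>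
  Derive (fun s => F t (x + s) (fun i j => J i j + s * J i (S j))) 0.

(* Coefficient of d/d(J i j) in the prolongation of Q, by the recursion
   zeta_(K+t) = D_t zeta_K - u_(K+t) D_t tau - u_(K+x) D_t xi
   and its analogue in x, starting from eta. *)
Fixpoint prolong_t (Q : vector_field) (i : nat) : jet_fun :=
  match i with
  | O => lift0 (eta Q)
  | S i' => fun t x J =>
      total_t (prolong_t Q i') t x J
      - J (S i') 0%nat * total_t (lift0 (tau Q)) t x J
      - J i' 1%nat * total_t (lift0 (xi Q)) t x J
  end.

Fixpoint prolong (Q : vector_field) (i j : nat) : jet_fun :=
  match j with
  | O => prolong_t Q i
  | S j' => fun t x J =>
      total_x (prolong Q i j') t x J
      - J (S i) j' * total_x (lift0 (tau Q)) t x J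
      - J i (S j') * total_x (lift0 (xi Q)) t x J
  end.

(* The prolonged vector field applied to F, as a directional derivative. *)
Definition apply_prolonged (Q : vector_field) (F : jet_fun) : jet_fun :=
  fun t x J =>
    Derive (fun s => F (t + s * lift0 (tau Q) t x J)
                       (x + s * lift0 (xi Q) t x J)
                       (fun i j => J i j + s * prolong Q i j t x J)) 0.

(* Infinitesimal invariance criterion for F = 0; I is the range of t. *)
Definition lie_symmetry (I : R -> Prop) (F : jet_fun) (Q : vector_field) : Prop :=
  forall t x J, I t -> F t x J = 0 -> apply_prolonged Q F t x J = 0.

(* The span of Q is one-dimensional. *)
Definition nonzero_field (I : R -> Prop) (Q : vector_field) : Prop :=
  exists t x u, I t /\ ~ (tau Q t x u = 0 /\ xi Q t x u = 0 /\ eta Q t x u = 0).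

Definition open_2d (D : R -> R -> Prop) : Prop :=
  forall t x, D t x -> locally_2d D t x.

(* Differentiability and the invariant surface condition
   tau * u_t + xi * u_x = eta. *)
Definition invariant_on (D : R -> R -> Prop) (Q : vector_field)
    (u : R -> R -> R) : Prop :=
  forall t x, D t x ->
    differentiable_pt u t x /\
    tau Q t x (u t x) * Derive (fun s => u s x) t
    + xi Q t x (u t x) * Derive (u t) x = eta Q t x (u t x).

(* U t x v is the ansatz with v in place of phi(omega). *)
Definition has_form_on (D : R -> R -> Prop) (omega : R -> R -> R)
    (U : R -> R -> R -> R) (phi : R -> R) (u : R -> R -> R) : Prop :=
  forall t x, D t x -> u t x = U t x (phi (omega t x)).

(* The level sets of omega in an open set D may be disconnected, so that phi
   exists in general only near each point of D. *)
Definition locally_has_form (D : R -> R -> Prop) (omega : R -> R -> R)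
    (U : R -> R -> R -> R) (u : R -> R -> R) : Prop :=
  forall t x, D t x ->
    exists (V : R -> R -> Prop) (phi : R -> R),
      open_2d V /\ V t x /\ (forall s y, V s y -> D s y) /\
      (forall s y, V s y -> ex_derive phi (omega s y)) /\
      has_form_on V omega U phi u.

(* Classical solution: the derivatives entering the equation exist. *)
Definition solves_on (D : R -> R -> Prop) (beta : R -> R)
    (u : R -> R -> R) : Prop :=
  forall t x, D t x ->
    ex_derive (fun s => u s x) t /\
    (forall k, (k <= 5)%nat -> ex_derive_n (u t) k x) /\
    equation beta t x (jet_of u t x) = 0.

(* The ordinary differential equation E(w, p) = 0 of order n, where p k stands
   for the k-th derivative of phi at w, on the range of omega over D. *)
Definition solves_ode_on (D : R -> R -> Prop) (omega : R -> R -> R)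
    (n : nat) (E : R -> (nat -> R) -> R) (phi : R -> R) : Prop :=
  forall t x, D t x ->
    (forall k, (k <= n)%nat -> ex_derive_n phi k (omega t x)) /\
    E (omega t x) (fun k => Derive_n phi k (omega t x)) = 0.

(* Q spans a one-dimensional Lie symmetry algebra of the equation with
   coefficient beta, its invariant functions are those given by the ansatz U,
   and the ansatz reduces the equation to E = 0. *)
Definition lie_reduction (I : R -> Prop) (beta : R -> R) (Q : vector_field)
    (omega : R -> R -> R) (U : R -> R -> R -> R)
    (n : nat) (E : R -> (nat -> R) -> R) : Prop :=
  nonzero_field I Q /\
  lie_symmetry I (equation beta) Q /\
  (forall (D : R -> R -> Prop) (u : R -> R -> R),
     open_2d D -> (forall t x, D t x -> I t) ->
     (invariant_on D Q u <-> locally_has_form D omega U u)) /\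
  (forall (D : R -> R -> Prop) (u : R -> R -> R) (phi : R -> R),
     open_2d D -> (forall t x, D t x -> I t) ->
     has_form_on D omega U phi u ->
     (solves_on D beta u <-> solves_ode_on D omega n E phi)).

(* Main.v *)
(* All the fields are affine: tau = T(t), xi = A(t) x + B(t),
   eta = C(t) u + e x + g. Their prolongations have a closed form in which only
   the order in x enters, and the symmetry condition becomes T' = A - C, A' = e,
   B' = g, C' = -e, T beta' = (4 A + C) beta. Where T <> 0, every characteristic
   is a graph over the t-axis, so an invariant function is determined by its
   values on one line t = t0; in Case 0 (T = 0) the characteristics are the lines
   of constant t instead. Since omega is affine in x, the x-derivatives of u and
   the derivatives of phi exist together, and substituting the ansatz gives
   ck^2 cm times the reduced equation. *)
Require Import Defs.
From Stdlib Require Import Reals Lra Lia FunctionalExtensionality.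
From Coquelicot Require Import Coquelicot.
Open Scope R_scope.

(** The cases are proved for data in a uniform affine shape; the stated formulas agree with that
    shape only pointwise, by [ring], and this lemma carries the result across. *)
Lemma lie_reduction_ext (I : R -> Prop) (beta beta' : R -> R)
    (Q Q' : vector_field) (omega omega' : R -> R -> R)
    (U U' : R -> R -> R -> R) (n : nat) (E E' : R -> (nat -> R) -> R) :
  (forall t, beta t = beta' t) ->
  (forall t x u, tau Q t x u = tau Q' t x u) ->
  (forall t x u, xi Q t x u = xi Q' t x u) ->
  (forall t x u, eta Q t x u = eta Q' t x u) ->
  (forall t x, omega t x = omega' t x) ->
  (forall t x v, U t x v = U' t x v) ->
  (forall w p, E w p = E' w p) ->
  lie_reduction I beta Q omega U n E -> lie_reduction I beta' Q' omega' U' n E'.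
Proof.
intros Hb Ht Hx He Ho HU HE.
replace beta' with beta by (apply functional_extensionality; exact Hb).
replace Q' with Q.
2: { destruct Q, Q'; simpl in *.
     f_equal; do 3 (apply functional_extensionality; intro); auto. }
replace omega' with omega
  by (do 2 (apply functional_extensionality; intro); auto).
replace U' with U by (do 3 (apply functional_extensionality; intro); auto).
replace E' with E by (do 2 (apply functional_extensionality; intro); auto).
auto.
Qed.

(** * Affine fields: prolongation and symmetry criterion *)

Definition affine_field (T A B C : R -> R) (e g : R) : vector_field :=
  VectorField (fun t _ _ => T t) (fun t x _ => A t * x + B t)
    (fun t x u => C t * u + e * x + g).

(* Stated with an eta-expanded function, as [auto_derive] produces it. *)
Lemma Derive_eta (f : R -> R) (t l : R) :
  is_derive f t l -> Derive (fun s : R => f s) t = l.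
Proof. apply is_derive_unique. Qed.

(** Each [D_x] costs one more [A t], from [D_x xi], and no mixed derivative enters because [tau]
    depends on [t] alone. The term [e * x] of [eta] leaves [e] at first order and nothing later. *)
Lemma prolong_affine_field_x (T A B C : R -> R) (e g : R) (j : nat) t x J :
  prolong (affine_field T A B C e g) 0 (S j) t x J =
  (C t - INR (S j) * A t) * J 0%nat (S j) + match j with O => e | _ => 0 end.
Proof.
revert t x J; induction j as [|j IH]; intros t x J.
- simpl; unfold total_x, lift0; simpl.
  rewrite (is_derive_unique _ _ (C t * J 0%nat 1%nat + e)),
    (is_derive_unique _ _ 0), (is_derive_unique _ _ (A t)); try ring.
  + auto_derive; auto; ring.
  + auto_derive; auto.
  + auto_derive; auto; ring.
- change (prolong (affine_field T A B C e g) 0 (S (S j)) t x J) with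
    (total_x (prolong (affine_field T A B C e g) 0 (S j)) t x J
      - J 1%nat (S j) * total_x (lift0 (fun t _ _ => T t)) t x J
      - J 0%nat (S (S j)) * total_x (lift0 (fun t x _ => A t * x + B t)) t x J).
  unfold total_x, lift0.
  rewrite (Derive_ext _ _ 0 (fun s => IH t (x + s) _)).
  rewrite (S_INR (S j)); generalize (INR (S j)); intro c.
  rewrite (is_derive_unique _ _ ((C t - c * A t) * J 0%nat (S (S j)))),
    (is_derive_unique _ _ 0), (is_derive_unique _ _ (A t)).
  + ring.
  + auto_derive; auto; ring.
  + auto_derive; auto.
  + auto_derive; auto; ring.
Qed.

(** The factor of [u_t] is [C - T'], which the relation [T' = A - C] turns into [2 C - A]. *)
Lemma prolong_affine_field_t (T A B C : R -> R) (e g t x : R) J :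
  is_derive T t (A t - C t) -> is_derive A t e -> is_derive B t g ->
  is_derive C t (- e) ->
  prolong (affine_field T A B C e g) 1 0 t x J =
  - e * J 0%nat 0%nat + (2 * C t - A t) * J 1%nat 0%nat
  - (e * x + g) * J 0%nat 1%nat.
Proof.
intros HT HA HB HC; simpl; unfold total_t, lift0; simpl.
rewrite (is_derive_unique _ _ (- e * J 0%nat 0%nat + C t * J 1%nat 0%nat)),
  (is_derive_unique _ _ (A t - C t)), (is_derive_unique _ _ (e * x + g)).
- ring.
(* The total derivative is taken at [s = 0] in [t + s], so derivatives are required at [t + 0]. *)
- rewrite <- (Rplus_0_r t) in HA, HB.
  auto_derive; [repeat split; [now exists e | now exists g] |].
  rewrite (Derive_eta _ _ _ HA), (Derive_eta _ _ _ HB); ring.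
- rewrite <- (Rplus_0_r t) in HT.
  auto_derive; [eexists; exact HT |].
  rewrite (Derive_eta _ _ _ HT), Rplus_0_r; ring.
- rewrite <- (Rplus_0_r t) in HC.
  auto_derive; [eexists; exact HC |].
  rewrite (Derive_eta _ _ _ HC), Rplus_0_r; ring.
Qed.

(** Under these relations the prolonged field multiplies the left-hand side of the equation by
    [2 C - A], so the result vanishes on solutions. Differentiating [beta] only along [T] also
    covers [T = 0] with arbitrary [beta]. *)
Lemma affine_field_symmetry (I : R -> Prop) (beta T A B C : R -> R) (e g : R) :
  (forall t, I t -> is_derive T t (A t - C t)) ->
  (forall t, I t -> is_derive A t e) ->
  (forall t, I t -> is_derive B t g) ->
  (forall t, I t -> is_derive C t (- e)) ->
  (forall t, I t ->
     is_derive (fun s => beta (t + s * T t)) 0 ((4 * A t + C t) * beta t)) ->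
  lie_symmetry I (equation beta) (affine_field T A B C e g).
Proof.
intros HT HA HB HC Hb t x J It Hsol.
assert (E1 := prolong_affine_field_x T A B C e g 0 t x J).
assert (E5 := prolong_affine_field_x T A B C e g 4 t x J).
assert (Et := prolong_affine_field_t T A B C e g t x J
  (HT t It) (HA t It) (HB t It) (HC t It)).
assert (E0 : prolong (affine_field T A B C e g) 0 0 t x J =
  C t * J 0%nat 0%nat + e * x + g) by reflexivity.
unfold apply_prolonged, equation in *.
(* Only four prolongation coefficients enter the equation; hiding the recursion keeps [simpl] from
   unfolding them. *)
revert E0 E1 E5 Et; set (p := prolong _); clearbody p; intros.
specialize (Hb t It); simpl in E1, E5 |- *.
unfold lift0; simpl.
pose (b := fun s : R => beta (t + s * T t)).
change (is_derive b 0 ((4 * A t + C t) * beta t)) in Hb.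
assert (b0 : b 0 = beta t) by (unfold b; f_equal; ring).
apply is_derive_unique.
apply (is_derive_ext (fun s =>
  (J 1%nat 0%nat + s * p 1%nat 0%nat t x J)
  + (J 0%nat 0%nat + s * p 0%nat 0%nat t x J)
    * (J 0%nat 1%nat + s * p 0%nat 1%nat t x J)
  + b s * (J 0%nat 5%nat + s * p 0%nat 5%nat t x J))); [reflexivity |].
clearbody b.
auto_derive; [eexists; exact Hb |].
rewrite (Derive_eta _ _ _ Hb), b0, E0, E1, E5, Et.
replace (J 1%nat 0%nat) with
  (- (J 0%nat 0%nat * J 0%nat 1%nat + beta t * J 0%nat 5%nat)) by lra.
ring.
Qed.

(** * Affine ansatzes: differentiation and invariance *)

(* omega = cm x + cn and u = ck phi(omega) + cl x + cr, with coefficients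
   depending on t. *)
Record coeffs := Coeffs { cm : R -> R; cn : R -> R; ck : R -> R; cl : R -> R; cr : R -> R }.

Definition aff_var (c : coeffs) (t x : R) : R := cm c t * x + cn c t.

Definition aff_ansatz (c : coeffs) (t x v : R) : R :=
  ck c t * v + cl c t * x + cr c t.

(** Storing the derivatives as another [coeffs] makes [aff_var d] and, for fixed [v], [aff_ansatz d]
    the [t]-derivatives of [aff_var c] and [aff_ansatz c]. *)
Definition derivative_coeffs (c d : coeffs) (t : R) : Prop :=
  is_derive (cm c) t (cm d t) /\ is_derive (cn c) t (cn d t) /\
  is_derive (ck c) t (ck d t) /\ is_derive (cl c) t (cl d t) /\
  is_derive (cr c) t (cr d t).

Lemma is_derive_ansatz_t (c d : coeffs) (phi : R -> R) (t x p : R) :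
  derivative_coeffs c d t -> is_derive phi (aff_var c t x) p ->
  is_derive (fun s => aff_ansatz c s x (phi (aff_var c s x))) t
    (aff_ansatz d t x (phi (aff_var c t x)) + ck c t * (p * aff_var d t x)).
Proof.
destruct c as [m n k l r], d as [m' n' k' l' r'].
unfold derivative_coeffs, aff_ansatz, aff_var; simpl.
intros (Hm & Hn & Hk & Hl & Hr) Hp.
auto_derive.
- repeat split; eexists; eassumption.
- rewrite (Derive_eta _ _ _ Hm), (Derive_eta _ _ _ Hn), (Derive_eta _ _ _ Hk),
    (Derive_eta _ _ _ Hl), (Derive_eta _ _ _ Hr), (Derive_eta _ _ _ Hp); ring.
Qed.

Lemma is_derive_ansatz_x (c : coeffs) (phi : R -> R) (t x p : R) :
  is_derive phi (aff_var c t x) p ->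
  is_derive (fun y => aff_ansatz c t y (phi (aff_var c t y))) x
    (ck c t * cm c t * p + cl c t).
Proof.
unfold aff_ansatz, aff_var; intros Hp.
auto_derive.
- eexists; eassumption.
- rewrite (Derive_eta _ _ _ Hp); ring.
Qed.

(** Chain rule through addition, whose linear approximation has zero remainder. *)
Lemma differentiable_pt_lim_plus (f h : R -> R -> R) (x y a b a' b' : R) :
  differentiable_pt_lim f x y a b -> differentiable_pt_lim h x y a' b' ->
  differentiable_pt_lim (fun u v => f u v + h u v) x y (a + a') (b + b').
Proof.
intros Hf Hh.
assert (P : differentiable_pt_lim (fun u v => u + v) (f x y) (h x y) 1 1).
{ intros eps; apply locally_2d_forall; intros u v.
  match goal with |- Rabs ?e <= _ => replace e with 0 by ring end.
  rewrite Rabs_R0; apply Rmult_le_pos; [apply Rlt_le, cond_pos |].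
  eapply Rle_trans; [apply Rabs_pos | apply Rmax_l]. }
generalize (differentiable_pt_lim_comp _ _ _ _ _ _ _ _ _ _ _ P Hf Hh).
now rewrite !Rmult_1_l.
Qed.

(** Chain rule through multiplication, whose remainder is the product of the two increments. *)
Lemma differentiable_pt_lim_mult (f h : R -> R -> R) (x y a b a' b' : R) :
  differentiable_pt_lim f x y a b -> differentiable_pt_lim h x y a' b' ->
  differentiable_pt_lim (fun u v => f u v * h u v) x y
    (h x y * a + f x y * a') (h x y * b + f x y * b').
Proof.
intros Hf Hh.
assert (P : differentiable_pt_lim (fun u v => u * v) (f x y) (h x y)
  (h x y) (f x y)).
{ intros eps; exists eps; intros u v Hu Hv.
  match goal with |- Rabs ?e <= _ =>
    replace e with ((u - f x y) * (v - h x y)) by ring end.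
  rewrite Rabs_mult; apply Rmult_le_compat; try apply Rabs_pos.
  - now apply Rlt_le.
  - apply Rmax_r. }
exact (differentiable_pt_lim_comp _ _ _ _ _ _ _ _ _ _ _ P Hf Hh).
Qed.

Lemma differentiable_pt_ansatz (c d : coeffs) (phi : R -> R) (t x : R) :
  derivative_coeffs c d t -> ex_derive phi (aff_var c t x) ->
  differentiable_pt (fun s y => aff_ansatz c s y (phi (aff_var c s y))) t x.
Proof.
intros (Hm & Hn & Hk & Hl & Hr) [p Hp]; unfold aff_ansatz, aff_var in *.
assert (D1 : forall f a, is_derive f t a ->
  differentiable_pt_lim (fun s y => f s) t x a 0).
{ intros f a Hf; apply differentiable_pt_lim_proj1_0, is_derive_Reals, Hf. }
assert (D2 : differentiable_pt_lim (fun s y => y) t x 0 1).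
{ intros eps; apply locally_2d_forall; intros u v.
  match goal with |- Rabs ?e <= _ => replace e with 0 by ring end.
  rewrite Rabs_R0; apply Rmult_le_pos; [apply Rlt_le, cond_pos |].
  eapply Rle_trans; [apply Rabs_pos | apply Rmax_l]. }
eexists; eexists.
apply differentiable_pt_lim_plus; [| apply D1; exact Hr].
apply differentiable_pt_lim_plus;
  [| apply differentiable_pt_lim_mult; [apply D1; exact Hl | exact D2]].
apply differentiable_pt_lim_mult; [apply D1; exact Hk |].
(* [phi] gets a dummy second argument, with partial derivative 0, to fit the two-variable chain
   rule. *)
apply (differentiable_pt_lim_comp (fun w _ => phi w)
  (fun s y => cm c s * y + cn c s) (fun s y => y) t x p 0).
- apply differentiable_pt_lim_proj1_0, is_derive_Reals, Hp.
- apply differentiable_pt_lim_plus; [| apply D1; exact Hn].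
  apply differentiable_pt_lim_mult; [apply D1; exact Hm | exact D2].
- exact D2.
Qed.

(* [omega] is constant along the characteristics of the field, and the ansatz
   satisfies the invariant surface condition for each fixed value of [v]. *)
Definition ansatz_compatible (T A B C : R -> R) (e g : R) (c d : coeffs) (t : R)
    : Prop :=
  T t * cm d t = - A t * cm c t /\
  T t * cn d t = - B t * cm c t /\
  T t * ck d t = C t * ck c t /\
  T t * cl d t = (C t - A t) * cl c t + e /\
  T t * cr d t = C t * cr c t - B t * cl c t + g.

Lemma ansatz_invariant (I : R -> Prop) (T A B C : R -> R) (e g : R)
    (c d : coeffs) (D : R -> R -> Prop) (u : R -> R -> R) :
  (forall t, I t -> derivative_coeffs c d t) ->
  (forall t, I t -> ansatz_compatible T A B C e g c d t) ->
  (forall t x, D t x -> I t) ->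
  locally_has_form D (aff_var c) (aff_ansatz c) u ->
  invariant_on D (affine_field T A B C e g) u.
Proof.
intros Hd Hc DI HF t x Dtx.
destruct (HF t x Dtx) as (V & phi & oV & Vtx & VD & dphi & form).
assert (It := DI t x Dtx).
specialize (Hd t It); specialize (dphi t x Vtx).
assert (loc : locally_2d
  (fun s y => aff_ansatz c s y (phi (aff_var c s y)) = u s y) t x).
{ destruct (oV t x Vtx) as [eps He]; exists eps; intros s y Hs Hy.
  symmetry; apply form; auto. }
split.
- destruct (differentiable_pt_ansatz c d phi t x Hd dphi) as (a & b & Hab).
  exists a, b; exact (differentiable_pt_lim_ext _ _ _ _ _ _ loc Hab).
- destruct dphi as [p Hp].
  assert (Dt : Derive (fun s : R => u s x) t =
    aff_ansatz d t x (phi (aff_var c t x)) + ck c t * (p * aff_var d t x)).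
  { apply is_derive_unique.
    apply (is_derive_ext_loc _ _ _ _ (locally_2d_1d_const_y _ _ _ loc)).
    now apply is_derive_ansatz_t. }
  assert (Dx : Derive (u t) x = ck c t * cm c t * p + cl c t).
  { apply is_derive_unique.
    apply (is_derive_ext_loc _ _ _ _ (locally_2d_1d_const_x _ _ _ loc)).
    now apply is_derive_ansatz_x. }
  rewrite Dt, Dx.
  rewrite (form t x Vtx); unfold affine_field, aff_ansatz, aff_var; simpl.
  destruct (Hc t It) as (Em & En & Ek & El & Er).
  generalize (phi (cm c t * x + cn c t)); intros v.
  (* This grouping exhibits the left-hand sides of the compatibility relations; the terms in [p]
     cancel since [omega] is constant along characteristics. *)
  transitivity (T t * ck d t * v + T t * cl d t * x + T t * cr d t
    + ck c t * p * (T t * cm d t * x + T t * cn d t)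
    + (A t * x + B t) * (ck c t * cm c t * p + cl c t)); [ring |].
  rewrite Em, En, Ek, El, Er; ring.
Qed.

(** * Invariant functions have the form of the ansatz *)

Lemma eq_of_zero_derivative (f : R -> R) (a b : R) :
  (forall t, Rmin a b <= t <= Rmax a b -> is_derive f t 0) -> f a = f b.
Proof.
intros H; destruct (Rtotal_order a b) as [L | [-> | L]]; [| reflexivity |].
- apply (eq_is_derive f); [| exact L]; intros t Ht; apply H.
  now rewrite Rmin_left, Rmax_right by lra.
- symmetry; apply (eq_is_derive f); [| exact L]; intros t Ht; apply H.
  now rewrite Rmin_right, Rmax_left by lra.
Qed.

Lemma between_Rabs (a b t d : R) :
  Rmin a b <= t <= Rmax a b -> Rabs (b - a) < d -> Rabs (t - a) < d.
Proof.
unfold Rmin, Rmax; destruct (Rle_dec a b); intros H; unfold Rabs;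
  destruct (Rcase_abs (b - a)), (Rcase_abs (t - a)); lra.
Qed.

Lemma continuity_2d_pt_of_derivative (f : R -> R) (t x a : R) :
  is_derive f t a -> continuity_2d_pt (fun s _ => f s) t x.
Proof.
intros H; apply differentiable_continuity_pt; exists a, 0.
apply differentiable_pt_lim_proj1_0, is_derive_Reals, H.
Qed.

Lemma locally_2d_Rabs_lt (f : R -> R -> R) (x y z d : R) :
  continuity_2d_pt f x y -> Rabs (f x y - z) < d ->
  locally_2d (fun u v => Rabs (f u v - z) < d) x y.
Proof.
intros Hf Hd; assert (P : 0 < d - Rabs (f x y - z)) by lra.
destruct (Hf (mkposreal _ P)) as [r Hr]; simpl in Hr.
exists r; intros u v Hu Hv; specialize (Hr u v Hu Hv).
replace (f u v - z) with ((f u v - f x y) + (f x y - z)) by ring.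
eapply Rle_lt_trans; [apply Rabs_triang | lra].
Qed.

Lemma differentiable_pt_lim_is_derive (u : R -> R -> R) (t x a b : R) :
  differentiable_pt_lim u t x a b ->
  is_derive (fun s => u s x) t a /\ is_derive (u t) x b.
Proof.
intros H; split; apply is_derive_Reals.
- replace a with (a * 1 + b * 0) by ring.
  apply (derivable_pt_lim_comp_2d u (fun s => s) (fun _ => x)); auto.
  + apply derivable_pt_lim_id.
  + apply derivable_pt_lim_const.
- replace b with (a * 0 + b * 1) by ring.
  apply (derivable_pt_lim_comp_2d u (fun _ => t) (fun y => y)); auto.
  + apply derivable_pt_lim_const.
  + apply derivable_pt_lim_id.
Qed.

(* On the box [|s - t0| < delta, |omega - w0| < delta] every characteristic
   [omega = w] meets the line [t = t0], and [phi w] is read off there. *)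
Lemma invariant_has_form (I : R -> Prop) (T A B C : R -> R) (e g : R)
    (c d : coeffs) (D : R -> R -> Prop) (u : R -> R -> R) :
  (forall t, I t -> derivative_coeffs c d t) ->
  (forall t, I t -> ansatz_compatible T A B C e g c d t) ->
  (forall t, I t -> T t <> 0 /\ cm c t <> 0 /\ ck c t <> 0) ->
  open_2d D -> (forall t x, D t x -> I t) ->
  invariant_on D (affine_field T A B C e g) u ->
  locally_has_form D (aff_var c) (aff_ansatz c) u.
Proof.
intros Hd Hc Hnz oD DI Hinv t0 x0 D0.
set (w0 := aff_var c t0 x0).
(* [X s w] is the position at time [s] on the characteristic [omega = w]. *)
pose (X := fun s w => (w - cn c s) / cm c s).
assert (I0 := DI t0 x0 D0).
assert (Xvar : forall s y, I s -> X s (aff_var c s y) = y).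
{ intros s y Is; unfold X, aff_var; field; apply Hnz, Is. }
assert (varX : forall s w, I s -> aff_var c s (X s w) = w).
{ intros s w Is; unfold X, aff_var; field; apply Hnz, Is. }
destruct (oD t0 x0 D0) as [e0 He0].
assert (cX : continuity_2d_pt X t0 w0).
{ destruct (Hd t0 I0) as (Hm & Hn & _).
  apply continuity_2d_pt_mult.
  - apply continuity_2d_pt_minus; [apply continuity_2d_pt_id2 |].
    eapply continuity_2d_pt_of_derivative; exact Hn.
  - apply continuity_2d_pt_inv; [| apply Hnz, I0].
    eapply continuity_2d_pt_of_derivative; exact Hm. }
(* The box is chosen so small that [X] stays within [e0] of [x0], hence [(s, X s w)] stays in
   [D]. *)
destruct (cX e0) as [d0 Hd0].
assert (dpos : 0 < Rmin e0 d0) by (apply Rmin_pos; apply cond_pos).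
set (dl := Rmin e0 d0) in *.
assert (inD : forall s w, Rabs (s - t0) < dl -> Rabs (w - w0) < dl ->
  D s (X s w)).
{ intros s w Hs Hw; apply He0.
  - eapply Rlt_le_trans; [exact Hs | apply Rmin_l].
  - rewrite <- (Xvar t0 x0 I0) at 1.
    apply Hd0; eapply Rlt_le_trans; eauto; apply Rmin_r. }
assert (inI : forall s, Rabs (s - t0) < dl -> I s).
{ intros s Hs; apply (DI s (X s w0)), inD; auto.
  now rewrite Rminus_diag, Rabs_R0. }
(* The ansatz solved for [phi] at time [s] of the characteristic [w]. By the surface condition its
   derivative in [s] is zero, so the time of reading is immaterial. *)
pose (h := fun w s => (u s (X s w) - cl c s * X s w - cr c s) / ck c s).
assert (hconst : forall s w, Rabs (s - t0) < dl -> Rabs (w - w0) < dl ->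
  h w t0 = h w s).
{ intros s w Hs Hw; apply eq_of_zero_derivative; intros z Hz.
  assert (Hz' := between_Rabs _ _ _ _ Hz Hs).
  assert (Iz := inI z Hz').
  destruct (Hinv z (X z w) (inD z w Hz' Hw)) as [(a & b & Hab) surf].
  destruct (differentiable_pt_lim_unique _ _ _ _ _ Hab) as [Ea Eb].
  rewrite Ea in surf; change (Derive (u z) (X z w)) with
    (Derive (fun y => u z y) (X z w)) in surf; rewrite Eb in surf.
  destruct (Hd z Iz) as (Hm & Hn & Hk & Hl & Hr).
  destruct (Hc z Iz) as (Em & En & Ek & El & Er).
  destruct (Hnz z Iz) as (NT & Nm & Nk).
  (* The curve [X] moves with velocity [xi / tau]; this is where [T <> 0] is used. *)
  assert (HX : is_derive (fun s => X s w) z ((A z * X z w + B z) / T z)).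
  { unfold X; auto_derive.
    - repeat split; try (eexists; eassumption); exact Nm.
    - rewrite (Derive_eta _ _ _ Hm), (Derive_eta _ _ _ Hn).
      replace (cm d z) with (- A z * cm c z / T z)
        by (rewrite <- Em; field; exact NT).
      replace (cn d z) with (- B z * cm c z / T z)
        by (rewrite <- En; field; exact NT).
      field; auto. }
  assert (HF : is_derive (fun s => u s (X s w)) z
    (a * 1 + b * ((A z * X z w + B z) / T z))).
  { apply is_derive_Reals.
    apply (derivable_pt_lim_comp_2d u (fun s => s) (fun s => X s w)).
    - exact Hab.
    - apply derivable_pt_lim_id.
    - apply is_derive_Reals, HX. }
  simpl in surf.
  (* With [u] and [X] along the curve made opaque, what remains is a derivative in one variable. *)
  pose (F := fun s => u s (X s w)); pose (G := fun s => X s w).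
  change (is_derive F z (a * 1 + b * ((A z * G z + B z) / T z))) in HF.
  change (is_derive G z ((A z * G z + B z) / T z)) in HX.
  change (T z * a + (A z * G z + B z) * b = C z * F z + e * G z + g) in surf.
  change (is_derive (fun s => (F s - cl c s * G s - cr c s) / ck c s) z 0).
  clearbody F G.
  auto_derive.
  - repeat split; try (eexists; eassumption); exact Nk.
  - rewrite (Derive_eta _ _ _ HF), (Derive_eta _ _ _ HX), (Derive_eta _ _ _ Hl),
      (Derive_eta _ _ _ Hr), (Derive_eta _ _ _ Hk).
    replace (ck d z) with (C z * ck c z / T z)
      by (rewrite <- Ek; field; exact NT).
    replace (cl d z) with (((C z - A z) * cl c z + e) / T z)
      by (rewrite <- El; field; exact NT).
    replace (cr d z) with ((C z * cr c z - B z * cl c z + g) / T z)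
      by (rewrite <- Er; field; exact NT).
    replace a with ((C z * F z + e * G z + g - (A z * G z + B z) * b) / T z)
      by (rewrite <- surf; field; exact NT).
    field; auto. }
exists (fun s y => Rabs (s - t0) < dl /\ Rabs (aff_var c s y - w0) < dl),
  (fun w => h w t0).
assert (VD : forall s y, Rabs (s - t0) < dl /\ Rabs (aff_var c s y - w0) < dl ->
  D s y).
{ intros s y [Hs Hw]; rewrite <- (Xvar s y (inI s Hs)); auto. }
repeat split.
- intros s y [Hs Hw].
  assert (Is := inI s Hs).
  destruct (Hd s Is) as (Hm & Hn & _).
  assert (cv : continuity_2d_pt (aff_var c) s y).
  { unfold aff_var; apply continuity_2d_pt_plus;
      [apply continuity_2d_pt_mult; [| apply continuity_2d_pt_id2] |];
      eapply continuity_2d_pt_of_derivative; eassumption. }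
  apply locally_2d_and; apply locally_2d_Rabs_lt; auto.
  apply continuity_2d_pt_id1.
- now rewrite Rminus_diag, Rabs_R0.
- now fold w0; rewrite Rminus_diag, Rabs_R0.
- exact VD.
(* [phi] inherits differentiability from [u] on the line [t = t0], because [X t0] is affine in
   [w]. *)
- intros s y [_ Hw]; set (w := aff_var c s y) in *.
  assert (Hw0 : D t0 (X t0 w)).
  { apply inD; [now rewrite Rminus_diag, Rabs_R0 | exact Hw]. }
  destruct (Hinv _ _ Hw0) as [(a & b & Hab) _].
  destruct (Hnz t0 I0) as (_ & Nm & Nk).
  destruct (differentiable_pt_lim_is_derive _ _ _ _ _ Hab) as [_ HF].
  unfold h, X in *; auto_derive.
  repeat split; auto; now exists b.
- intros s y [Hs Hw].
  assert (Is := inI s Hs).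
  rewrite (hconst s _ Hs Hw); unfold aff_ansatz, h; rewrite (Xvar s y Is).
  field; apply Hnz, Is.
Qed.

(** * Substitution of the ansatz into the equation *)

Definition affine_jet (l r : R) (j : nat) (x : R) : R :=
  match j with O => l * x + r | 1%nat => l | _ => 0 end.

Lemma is_derive_affine_jet (l r : R) (j : nat) (x : R) :
  is_derive (affine_jet l r j) x (affine_jet l r (S j) x).
Proof. destruct j as [| [| j]]; unfold affine_jet; auto_derive; auto; ring. Qed.

(** Each differentiation brings out one factor [m]. The hypotheses hold near [x], not just at it, so
    that the induction formula is available on a neighbourhood and can be differentiated again. *)
Lemma Derive_n_affine_comp (f h : R -> R) (k m n l r : R) (N : nat) (x : R) :
  locally x (fun y => f y = k * h (m * y + n) + l * y + r) ->
  locally x (fun y =>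
    forall j, (j <= N)%nat -> ex_derive_n h j (m * y + n)) ->
  forall j, (j <= N)%nat ->
    ex_derive_n f j x /\
    Derive_n f j x = k * m ^ j * Derive_n h j (m * x + n) + affine_jet l r j x.
Proof.
intros Hf Hh j; revert x Hf Hh; induction j as [| j IH]; intros x Hf Hh Hj.
- split; [exact Logic.I |].
  simpl; rewrite (locally_singleton _ _ Hf); ring.
- assert (Hloc : locally x (fun y =>
    k * m ^ j * Derive_n h j (m * y + n) + affine_jet l r j y = Derive_n f j y)).
  { generalize (filter_and _ _ (locally_locally _ _ Hf) (locally_locally _ _ Hh)).
    apply filter_imp; intros y [Hfy Hhy]; symmetry; apply IH; auto; lia. }
  assert (Hd := locally_singleton _ _ Hh (S j) Hj); simpl in Hd.
  assert (P : is_derive (Derive_n f j) x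
    (k * m ^ S j * Derive_n h (S j) (m * x + n) + affine_jet l r (S j) x)).
  { apply (is_derive_ext_loc _ _ _ _ Hloc).
    apply @is_derive_plus; [| apply is_derive_affine_jet].
    apply Derive_correct in Hd; simpl.
    revert Hd; generalize (Derive_n h j); intros f' Hd.
    auto_derive; [eexists; exact Hd |].
    rewrite (Derive_eta _ _ _ Hd); ring. }
  split; [eexists; exact P | exact (is_derive_unique _ _ _ P)].
Qed.
(** For fixed [t], [omega] is an invertible affine function of [x], so [phi] is in turn an affine
    expression in [u t] composed with the inverse map. *)
Lemma has_form_ex_derive_n (c : coeffs) (D : R -> R -> Prop) (u : R -> R -> R)
    (phi : R -> R) (N : nat) :
  open_2d D ->
  (forall t x, D t x -> cm c t <> 0 /\ ck c t <> 0) ->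
  has_form_on D (aff_var c) (aff_ansatz c) phi u ->
  (forall t x, D t x -> forall j, (j <= N)%nat -> ex_derive_n (u t) j x) ->
  forall t x, D t x ->
  forall j, (j <= N)%nat -> ex_derive_n phi j (aff_var c t x).
Proof.
intros oD Hnz form Hu t x Dtx j Hj.
destruct (Hnz t x Dtx) as [Nm Nk].
set (m := cm c t) in *; set (k := ck c t) in *.
assert (loc : locally (aff_var c t x)
  (fun z => D t (/ m * z + - cn c t / m))).
{ assert (cont : continuous (fun z : R => / m * z + - cn c t / m)
    (aff_var c t x)).
  { refine (ex_derive_continuous (fun z : R => / m * z + - cn c t / m) _ _).
    auto_derive; auto. }
  apply cont.
  replace (/ m * aff_var c t x + - cn c t / m) with x
    by (unfold aff_var; fold m; field; exact Nm).
  exact (locally_2d_1d_const_x _ _ _ (oD t x Dtx)). }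
(* The constants expand [phi z = (u t x - l x - r) / k] at [x = (z - n) / m], with [n], [l], [r] the
   values of [cn], [cl], [cr] at [t]. *)
refine (proj1 (Derive_n_affine_comp phi (u t) (/ k) (/ m) (- cn c t / m)
  (- (cl c t / (k * m))) (cl c t * cn c t / (k * m) - cr c t / k) N _ _ _ j Hj)).
- refine (filter_imp _ _ (fun (z : R) Dz => _) loc).
  rewrite (form _ _ Dz); unfold aff_ansatz.
  replace (aff_var c t (/ m * z + - cn c t / m)) with z
    by (unfold aff_var; fold m; field; exact Nm).
  fold k; field; auto.
- revert loc; apply filter_imp; intros z Dz; exact (Hu _ _ Dz).
Qed.

(** One family containing the reduced equations of all cases but Case 0. *)
Definition reduced_ode (P Q S W Z : R) : R -> (nat -> R) -> R := fun w p =>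
  p 5%nat + (p 0%nat + P * w + Q) * p 1%nat + S * p 0%nat + W * w + Z.

(* Coefficients of the monomials in phi, phi', phi''''' and x that result from
   substituting the ansatz, compared with ck^2 * cm times the reduced equation. *)
Definition reduces_to (beta : R -> R) (P Q S W Z : R) (c d : coeffs) (t : R)
    : Prop :=
  beta t * cm c t ^ 4 = ck c t /\
  cm d t + cl c t * cm c t = P * (ck c t * cm c t) * cm c t /\
  cn d t + cr c t * cm c t = (ck c t * cm c t) * (P * cn c t + Q) /\
  ck d t + ck c t * cl c t = S * (ck c t * cm c t) * ck c t /\
  cl d t + cl c t ^ 2 = W * (ck c t * cm c t) ^ 2 /\
  cr d t + cr c t * cl c t = ck c t * (ck c t * cm c t) * (W * cn c t + Z).

(** For regular [phi] the two residuals differ by the nonzero factor [ck^2 cm]. Starting from a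
    solution [u], the regularity of [phi] has to be recovered first. *)
Lemma ansatz_reduction (I : R -> Prop) (beta : R -> R) (P Q S W Z : R)
    (c d : coeffs) (D : R -> R -> Prop) (u : R -> R -> R) (phi : R -> R) :
  (forall t, I t -> derivative_coeffs c d t) ->
  (forall t, I t -> reduces_to beta P Q S W Z c d t) ->
  (forall t, I t -> cm c t <> 0 /\ ck c t <> 0) ->
  open_2d D -> (forall t x, D t x -> I t) ->
  has_form_on D (aff_var c) (aff_ansatz c) phi u ->
  (solves_on D beta u <->
   solves_ode_on D (aff_var c) 5 (reduced_ode P Q S W Z) phi).
Proof.
intros Hd Hc Hnz oD DI form.
assert (key : (forall t x, D t x ->
    forall j, (j <= 5)%nat -> ex_derive_n phi j (aff_var c t x)) ->
  forall t x, D t x ->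
    ex_derive (fun s => u s x) t /\
    (forall j, (j <= 5)%nat -> ex_derive_n (u t) j x) /\
    equation beta t x (jet_of u t x) = ck c t ^ 2 * cm c t *
      reduced_ode P Q S W Z (aff_var c t x)
        (fun j => Derive_n phi j (aff_var c t x))).
{ intros Hphi t x Dtx.
  assert (It := DI t x Dtx); specialize (Hd t It).
  destruct (Hc t It) as (E5 & Em & En & Ek & El & Er).
  assert (Hx := Derive_n_affine_comp (u t) phi (ck c t) (cm c t) (cn c t)
    (cl c t) (cr c t) 5 x).
  assert (locx := locally_2d_1d_const_x _ _ _ (oD t x Dtx)).
  assert (loct := locally_2d_1d_const_y _ _ _ (oD t x Dtx)).
  specialize (Hx (filter_imp _ _ (fun y Dy => form t y Dy) locx)
    (filter_imp _ _ (fun y Dy => Hphi t y Dy) locx)).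
  assert (Ht : is_derive (fun s => u s x) t
    (aff_ansatz d t x (phi (aff_var c t x))
     + ck c t * (Derive_n phi 1 (aff_var c t x) * aff_var d t x))).
  { apply (is_derive_ext_loc
      (fun s => aff_ansatz c s x (phi (aff_var c s x)))).
    - revert loct; apply filter_imp; intros s Ds; symmetry; exact (form _ _ Ds).
    - apply is_derive_ansatz_t; [exact Hd |].
      apply Derive_correct, (Hphi t x Dtx 1%nat); lia. }
  split; [eexists; exact Ht |]; split; [intros j Hj; apply Hx, Hj |].
  unfold equation.
  change (jet_of u t x 1%nat 0%nat) with (Derive (fun s => u s x) t).
  change (jet_of u t x 0%nat) with (fun j => Derive_n (u t) j x).
  cbv beta.
  replace (Derive (fun s => u s x) t) with
    (aff_ansatz d t x (phi (aff_var c t x))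
     + ck c t * (Derive_n phi 1 (aff_var c t x) * aff_var d t x))
    by (symmetry; exact (is_derive_unique _ _ _ Ht)).
  rewrite !(fun j Hj => proj2 (Hx j Hj)) by lia.
  unfold affine_jet, reduced_ode.
  fold (aff_var c t x); unfold aff_ansatz.
  change (Derive_n phi 0 (aff_var c t x)) with (phi (aff_var c t x)).
  generalize (Derive_n phi 1 (aff_var c t x)) (Derive_n phi 5 (aff_var c t x))
    (phi (aff_var c t x)); intros p1 p5 p0.
  unfold aff_var.
  (* Each bracket is the left-hand side of one relation in [reduces_to]; of the five factors [cm]
     from the fifth derivative, four go with [beta]. *)
  transitivity (p0 * (ck d t + ck c t * cl c t)
    + ck c t * x * p1 * (cm d t + cl c t * cm c t)
    + ck c t * p1 * (cn d t + cr c t * cm c t)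
    + x * (cl d t + cl c t ^ 2) + (cr d t + cr c t * cl c t)
    + ck c t ^ 2 * cm c t * p0 * p1
    + ck c t * cm c t * p5 * (beta t * cm c t ^ 4)); [ring |].
  rewrite E5, Em, En, Ek, El, Er; ring. }
split.
- intros Hs.
  assert (Hphi : forall t x, D t x ->
    forall j, (j <= 5)%nat -> ex_derive_n phi j (aff_var c t x)).
  { apply (has_form_ex_derive_n c D u phi 5 oD); [| exact form |].
    - intros t x Dtx; apply Hnz, (DI t x Dtx).
    - intros t x Dtx; apply (Hs t x Dtx). }
  intros t x Dtx; split; [exact (Hphi t x Dtx) |].
  destruct (key Hphi t x Dtx) as (_ & _ & E).
  destruct (Hs t x Dtx) as (_ & _ & E'); rewrite E' in E.
  destruct (Hnz t (DI t x Dtx)) as [Nm Nk].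
  symmetry in E; apply Rmult_integral in E; destruct E as [E |]; [| assumption].
  exfalso; revert E; apply Rmult_integral_contrapositive_currified; auto.
  now apply pow_nonzero.
- intros Ho t x Dtx.
  destruct (key (fun t x Dtx => proj1 (Ho t x Dtx)) t x Dtx) as (H1 & H2 & E).
  repeat split; auto.
  rewrite E, (proj2 (Ho t x Dtx)); ring.
Qed.

(** With [T <> 0] a whole case comes down to these pointwise identities, and the condition on [beta]
    can be solved for its ordinary derivative. *)
Lemma affine_lie_reduction (I : R -> Prop) (beta T A B C : R -> R)
    (e g P Q S W Z : R) (c d : coeffs) :
  (exists t, I t) ->
  (forall t, is_derive T t (A t - C t)) ->
  (forall t, is_derive A t e) ->
  (forall t, is_derive B t g) ->
  (forall t, is_derive C t (- e)) ->
  (forall t, I t -> is_derive beta t ((4 * A t + C t) / T t * beta t)) ->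
  (forall t, I t -> T t <> 0 /\ cm c t <> 0 /\ ck c t <> 0) ->
  (forall t, I t -> derivative_coeffs c d t) ->
  (forall t, I t -> ansatz_compatible T A B C e g c d t) ->
  (forall t, I t -> reduces_to beta P Q S W Z c d t) ->
  lie_reduction I beta (affine_field T A B C e g) (aff_var c) (aff_ansatz c)
    5 (reduced_ode P Q S W Z).
Proof.
intros [t0 I0] HT HA HB HC Hb Hnz Hd Hc Hr; split; [| split; [| split]].
- exists t0, 0, 0; split; [exact I0 | intros [H _]; exact (proj1 (Hnz t0 I0) H)].
- apply affine_field_symmetry; auto.
  intros t It; specialize (Hb t It); destruct (Hnz t It) as [NT _].
  replace t with (t + 0 * T t) in Hb at 1 by ring.
  auto_derive; [eexists; exact Hb |].
  rewrite (Derive_eta _ _ _ Hb); field; exact NT.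
- intros D u oD DI; split.
  + now apply (invariant_has_form I) with (d := d).
  + now apply (ansatz_invariant I) with (d := d).
- intros D u phi oD DI form.
  apply (ansatz_reduction I) with (d := d); auto.
  intros t It; apply Hnz, It.
Qed.

(** * Case 0: characteristics of constant time *)

(** Here [cm = 0], so [omega] cannot be inverted in [x]. The surface condition [(t + a) u_x = 1] is
    integrated in [x] at fixed [t]; then [u] is affine in [x], the fifth derivative vanishes, and
    [u_t + u u_x] times [t + a] is the reduced equation. *)
Lemma galilean_reduction (beta : R -> R) (a : R) :
  lie_reduction (fun t => t + a <> 0) beta
    (VectorField (fun t x u => 0) (fun t x u => t + a) (fun t x u => 1))
    (fun t x => t) (fun t x v => v + x / (t + a))
    1 (fun w p => (w + a) * p 1%nat + p 0%nat).
Proof.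
set (I := fun t => t + a <> 0).
pose (c := Coeffs (fun _ => 0) (fun t => t) (fun _ => 1) (fun t => / (t + a))
  (fun _ => 0)).
pose (d := Coeffs (fun _ => 0) (fun _ => 1) (fun _ => 0)
  (fun t => - / (t + a) ^ 2) (fun _ => 0)).
assert (Hd : forall t, I t -> derivative_coeffs c d t).
{ intros t It; unfold derivative_coeffs; simpl.
  split; [| split; [| split; [| split]]]; auto_derive; auto; field; exact It. }
apply (lie_reduction_ext I beta beta
  (affine_field (fun _ => 0) (fun _ => 0) (fun t => t + a) (fun _ => 0) 0 1) _
  (aff_var c) _ (aff_ansatz c) _ 1 (fun w p => (w + a) * p 1%nat + p 0%nat));
  try reflexivity; try (intros; simpl; ring);
  try (intros; unfold aff_var, aff_ansatz, Rdiv; simpl; ring).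
split; [| split; [| split]].
- exists (1 - a), 0, 0; split; [unfold I; lra | simpl; lra].
- apply affine_field_symmetry; intros t It.
  1-4: auto_derive; auto; ring.
  (* Since [tau = 0], the argument of [beta] does not move. *)
  apply (is_derive_ext (fun _ => beta t)); [intros s; f_equal; ring |].
  replace ((4 * 0 + 0) * beta t) with 0 by ring; apply @is_derive_const.
- intros D u oD DI; split.
  + intros Hinv t0 x0 D0.
    destruct (oD t0 x0 D0) as [e0 He0].
    assert (P0 : Rabs (x0 - x0) < e0)
      by (rewrite Rminus_diag, Rabs_R0; apply cond_pos).
    (* [phi] is read off on the line [x = x0]. *)
    exists (fun s y => Rabs (s - t0) < e0 /\ Rabs (y - x0) < e0),
      (fun s => u s x0 - x0 / (s + a)).
    repeat split.
    * intros s y [Hs Hy]; apply locally_2d_and; apply locally_2d_Rabs_lt; auto.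
      -- apply continuity_2d_pt_id1.
      -- apply continuity_2d_pt_id2.
    * rewrite Rminus_diag, Rabs_R0; apply cond_pos.
    * exact P0.
    * intros s y [Hs Hy]; now apply He0.
    * intros s y [Hs Hy].
      assert (Ds : D s x0) by now apply He0.
      replace (aff_var c s y) with s by (unfold aff_var; simpl; ring).
      destruct (Hinv _ _ Ds) as [(b1 & b2 & Hb) _].
      destruct (differentiable_pt_lim_is_derive _ _ _ _ _ Hb) as [Hb1 _].
      auto_derive; repeat split; [eexists; exact Hb1 | exact (DI _ _ Ds)].
    * intros s y [Hs Hy].
      assert (Ds : D s x0) by now apply He0.
      assert (Is := DI _ _ Ds).
      pose (f := fun z => u s z - z / (s + a)).
      assert (E : f x0 = f y).
      { apply eq_of_zero_derivative; intros z Hz.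
        assert (Dz : D s z)
          by (apply He0; [exact Hs | exact (between_Rabs _ _ _ _ Hz Hy)]).
        destruct (Hinv _ _ Dz) as [(b1 & b2 & Hb) surf].
        destruct (differentiable_pt_lim_is_derive _ _ _ _ _ Hb) as [_ Hb2].
        simpl in surf.
        replace (Derive (u s) z) with b2 in surf
          by (symmetry; exact (is_derive_unique _ _ _ Hb2)).
        unfold f; auto_derive; [repeat split; auto; eexists; exact Hb2 |].
        rewrite (Derive_eta _ _ _ Hb2).
        apply (Rmult_eq_reg_l (s + a)); [| exact Is].
        field_simplify; [lra | exact Is]. }
      unfold f in E; unfold aff_ansatz, aff_var; simpl.
      rewrite Rmult_0_l, Rplus_0_l, E; field; exact Is.
  + apply (ansatz_invariant I) with (d := d); auto.
    intros t It; unfold ansatz_compatible; simpl.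
    repeat split; field; exact It.
- intros D u phi oD DI form.
  assert (Hx : forall t x, D t x ->
    forall j, (j <= 5)%nat -> ex_derive_n (u t) j x /\
    Derive_n (u t) j x = affine_jet (/ (t + a)) (phi t) j x).
  { intros t x Dtx j Hj.
    (* At fixed [t] the value [phi t] is just the constant term of an affine function of [x]. *)
    destruct (Derive_n_affine_comp (u t) (fun _ => 0) 0 0 0 (/ (t + a)) (phi t)
      5 x) with (j := j) as [E1 E2]; auto.
    - refine (filter_imp _ _ (fun (y : R) Dy => _)
        (locally_2d_1d_const_x _ _ _ (oD t x Dtx))).
      rewrite (form _ _ Dy); unfold aff_ansatz, aff_var; simpl.
      replace (0 * y + t) with t by ring; ring.
    - apply filter_forall; intros y i _; apply ex_derive_n_const.
    - split; [exact E1 | rewrite E2; ring]. }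
  assert (E : forall t x p, D t x -> is_derive phi t p ->
    is_derive (fun s => u s x) t (p - x / (t + a) ^ 2)).
  { intros t x p Dtx Hp.
    apply (is_derive_ext_loc (fun s => phi s + x / (s + a))).
    - refine (filter_imp _ _ (fun (s : R) Ds => _)
        (locally_2d_1d_const_y _ _ _ (oD t x Dtx))).
      rewrite (form _ _ Ds); unfold aff_ansatz, aff_var; simpl.
      replace (0 * x + s) with s by ring; unfold Rdiv; ring.
    - assert (It := DI _ _ Dtx).
      auto_derive; [repeat split; auto; eexists; exact Hp |].
      rewrite (Derive_eta _ _ _ Hp); field; exact It. }
  assert (eqn : forall t x p, D t x -> is_derive phi t p ->
    equation beta t x (jet_of u t x) * (t + a) = (t + a) * p + phi t).
  { intros t x p Dtx Hp; unfold equation.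
    change (jet_of u t x 1%nat 0%nat) with (Derive (fun s => u s x) t).
    change (jet_of u t x 0%nat) with (fun j => Derive_n (u t) j x).
    cbv beta.
    replace (Derive (fun s => u s x) t) with (p - x / (t + a) ^ 2)
      by (symmetry; exact (is_derive_unique _ _ _ (E t x p Dtx Hp))).
    rewrite !(fun j Hj => proj2 (Hx t x Dtx j Hj)) by lia.
    unfold affine_jet; field; exact (DI _ _ Dtx). }
  assert (var : forall t x, aff_var c t x = t)
    by (intros; unfold aff_var; simpl; ring).
  split.
  + intros Hs t x Dtx; rewrite var.
    assert (It := DI _ _ Dtx).
    destruct (Hs t x Dtx) as ([q Hq] & _ & Eq).
    (* At fixed [x], [phi] is locally [u s x - x / (s + a)]. *)
    assert (Hp : is_derive phi t (q + x / (t + a) ^ 2)).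
    { apply (is_derive_ext_loc (fun s => u s x - x / (s + a))).
      - refine (filter_imp _ _ (fun (s : R) Ds => _)
          (locally_2d_1d_const_y _ _ _ (oD t x Dtx))).
        rewrite (form _ _ Ds), var; unfold aff_ansatz; simpl.
        unfold Rdiv; ring.
      - auto_derive; [repeat split; auto; eexists; exact Hq |].
        rewrite (Derive_eta _ _ _ Hq); field; exact It. }
    split.
    * intros [| [| k]] Hk; [exact Logic.I | eexists; exact Hp | lia].
    * change (Derive_n phi 1 t) with (Derive phi t).
      rewrite (is_derive_unique _ _ _ Hp).
      transitivity (equation beta t x (jet_of u t x) * (t + a));
        [symmetry; now apply eqn | rewrite Eq; ring].
  + intros Ho t x Dtx; specialize (Ho t x Dtx); rewrite var in Ho.
    destruct Ho as [Hp Eq].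
    specialize (Hp 1%nat (le_n _)); apply Derive_correct in Hp.
    split; [eexists; exact (E t x _ Dtx Hp) |].
    split; [intros k Hk; apply (Hx t x Dtx k Hk) |].
    apply (Rmult_eq_reg_r (t + a)); [| exact (DI _ _ Dtx)].
    rewrite (eqn t x _ Dtx Hp), Rmult_0_l; exact Eq.
Qed.

(** * The remaining cases: fields with nonzero [tau] *)

(** Keeping the same power on the right lets [field] treat it as an atom. *)
Lemma is_derive_Rpower (r t : R) :
  0 < t -> is_derive (fun s => Rpower s r) t (r / t * Rpower t r).
Proof. intros Ht; unfold Rpower; auto_derive; auto; field; lra. Qed.

(** The similarity exponents [m] and [k] satisfy [k + m = -1], which makes [ck cm] equal to [/ t],
    and [rho + 4 m = k], which is the relation on [beta]. *)
Lemma power_reduction (rho : R) :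
  lie_reduction (fun t => 0 < t) (fun t => Rpower t rho)
    (VectorField (fun t x u => 5 * t) (fun t x u => (rho + 1) * x)
       (fun t x u => (rho - 4) * u))
    (fun t x => x * Rpower t (- ((rho + 1) / 5)))
    (fun t x v => Rpower t ((rho - 4) / 5) * v)
    5 (fun w p => p 5%nat + (p 0%nat - (rho + 1) / 5 * w) * p 1%nat
                  + (rho - 4) / 5 * p 0%nat).
Proof.
pose (m := - ((rho + 1) / 5)); pose (k := (rho - 4) / 5).
pose (c := Coeffs (fun t => Rpower t m) (fun _ => 0) (fun t => Rpower t k)
  (fun _ => 0) (fun _ => 0)).
pose (d := Coeffs (fun t => m / t * Rpower t m) (fun _ => 0)
  (fun t => k / t * Rpower t k) (fun _ => 0) (fun _ => 0)).
apply (lie_reduction_ext (fun t => 0 < t) (fun t => Rpower t rho) _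
  (affine_field (fun t => 5 * t) (fun _ => rho + 1) (fun _ => 0)
     (fun _ => rho - 4) 0 0) _
  (aff_var c) _ (aff_ansatz c) _ 5 (reduced_ode (- ((rho + 1) / 5)) 0 k 0 0));
  try (intros; unfold aff_var, aff_ansatz, reduced_ode; simpl; unfold m, k; ring).
apply (affine_lie_reduction _ _ _ _ _ _ _ _ _ _ _ _ _ c d).
- exists 1; lra.
- intros t; auto_derive; auto; ring.
- intros t; auto_derive; auto.
- intros t; auto_derive; auto.
- intros t; auto_derive; auto; ring.
- intros t Ht; evar_last; [now apply is_derive_Rpower | field; lra].
- intros t Ht; simpl; split; [lra |].
  split; apply Rgt_not_eq, exp_pos.
- intros t Ht; split; [| split; [| split; [| split]]]; simpl;
    try (now apply is_derive_Rpower); auto_derive; auto.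
- intros t Ht; unfold ansatz_compatible; simpl.
  repeat split; unfold m, k; field; lra.
- intros t Ht; unfold reduces_to; simpl.
  assert (E : Rpower t k * Rpower t m = / t).
  { rewrite <- Rpower_plus; replace (k + m) with (Ropp 1) by (unfold k, m; field).
    now rewrite Rpower_Ropp, Rpower_1. }
  rewrite E; repeat split; try (unfold m; field; lra).
  rewrite Rmult_1_r, <- !Rpower_plus; f_equal; unfold k, m; field.
Qed.

(** For [rho = -1] the scaling leaves [x] fixed, and a translation in [x] by [a] per unit of [ln t]
    is added to it. *)
Lemma log_reduction (a : R) :
  lie_reduction (fun t => 0 < t) (fun t => / t)
    (VectorField (fun t x u => t) (fun t x u => a) (fun t x u => - u))
    (fun t x => x - a * ln t)
    (fun t x v => / t * v)
    5 (fun w p => p 5%nat + (p 0%nat - a) * p 1%nat - p 0%nat).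
Proof.
pose (c := Coeffs (fun _ => 1) (fun t => - a * ln t) (fun t => / t)
  (fun _ => 0) (fun _ => 0)).
pose (d := Coeffs (fun _ => 0) (fun t => - a / t) (fun t => - / t ^ 2)
  (fun _ => 0) (fun _ => 0)).
apply (lie_reduction_ext (fun t => 0 < t) (fun t => / t) _
  (affine_field (fun t => t) (fun _ => 0) (fun _ => a) (fun _ => - 1) 0 0) _
  (aff_var c) _ (aff_ansatz c) _ 5 (reduced_ode 0 (- a) (- 1) 0 0));
  try (intros; unfold aff_var, aff_ansatz, reduced_ode; simpl; ring).
apply (affine_lie_reduction _ _ _ _ _ _ _ _ _ _ _ _ _ c d).
- exists 1; lra.
- intros t; auto_derive; auto; ring.
- intros t; auto_derive; auto.
- intros t; auto_derive; auto.
- intros t; auto_derive; auto; ring.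
- intros t Ht; auto_derive; [lra | field; lra].
- intros t Ht; simpl; repeat split; try lra.
  now apply Rinv_neq_0_compat, Rgt_not_eq.
- intros t Ht; split; [| split; [| split; [| split]]]; simpl;
    auto_derive; auto; try lra; field; lra.
- intros t Ht; unfold ansatz_compatible; simpl.
  repeat split; field; lra.
- intros t Ht; unfold reduces_to; simpl; repeat split; field; lra.
Qed.

Lemma exp_reduction :
  lie_reduction (fun t => True) (fun t => exp t)
    (VectorField (fun t x u => 5) (fun t x u => x) (fun t x u => u))
    (fun t x => x * exp (- t / 5))
    (fun t x v => exp (t / 5) * v)
    5 (fun w p => p 5%nat + (p 0%nat - 1 / 5 * w) * p 1%nat
                  + 1 / 5 * p 0%nat).
Proof.
pose (c := Coeffs (fun t => exp (- t / 5)) (fun _ => 0) (fun t => exp (t / 5))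
  (fun _ => 0) (fun _ => 0)).
pose (d := Coeffs (fun t => - 1 / 5 * exp (- t / 5)) (fun _ => 0)
  (fun t => 1 / 5 * exp (t / 5)) (fun _ => 0) (fun _ => 0)).
apply (lie_reduction_ext (fun t => True) exp _
  (affine_field (fun _ => 5) (fun _ => 1) (fun _ => 0) (fun _ => 1) 0 0) _
  (aff_var c) _ (aff_ansatz c) _ 5 (reduced_ode (- (1 / 5)) 0 (1 / 5) 0 0));
  try (intros; unfold aff_var, aff_ansatz, reduced_ode; simpl; ring).
apply (affine_lie_reduction _ _ _ _ _ _ _ _ _ _ _ _ _ c d).
- exists 0; exact Logic.I.
- intros t; auto_derive; auto; ring.
- intros t; auto_derive; auto.
- intros t; auto_derive; auto.
- intros t; auto_derive; auto; ring.
- intros t Ht; auto_derive; [auto | field].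
- intros t Ht; simpl; split; [lra |].
  split; apply Rgt_not_eq, exp_pos.
- intros t Ht; split; [| split; [| split; [| split]]]; simpl;
    auto_derive; auto; unfold Rdiv; ring.
- intros t Ht; unfold ansatz_compatible; simpl.
  repeat split; field.
- intros t Ht; unfold reduces_to; simpl.
  (* This is [ck cm = 1]; the relation on [beta] then compares [1 - 4/5] with [1/5]. *)
  assert (E : exp (t / 5) * exp (- t / 5) = 1).
  { rewrite <- exp_plus, <- exp_0; f_equal; field. }
  rewrite E; repeat split; try field.
  rewrite Rmult_1_r, <- !exp_plus; f_equal; field.
Qed.

Lemma is_derive_sqrt_sqr_plus_1 (t : R) :
  is_derive (fun s => sqrt (s ^ 2 + 1)) t (t / sqrt (t ^ 2 + 1)).
Proof.
assert (Hp : 0 < t ^ 2 + 1) by (generalize (pow2_ge_0 t); lra).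
assert (Hd : is_derive (fun s : R => s ^ 2 + 1) t (2 * t))
  by (auto_derive; auto; ring).
assert (Hs := sqrt_lt_R0 _ Hp).
evar_last; [exact (is_derive_sqrt _ _ _ Hd Hp) | cbv beta; field; lra].
Qed.

(** The exponential and the root contribute [b] and [- t], over [t^2 + 1], to the logarithmic
    derivative. Below, [b = - nu] gives [cm] and [b = nu] gives [ck]. *)
Lemma is_derive_exp_atan_div_sqrt (b t : R) :
  is_derive (fun s => exp (b * atan s) / sqrt (s ^ 2 + 1)) t
    ((b - t) / (t ^ 2 + 1) * (exp (b * atan t) / sqrt (t ^ 2 + 1))).
Proof.
assert (Hp : 0 < t ^ 2 + 1) by (generalize (pow2_ge_0 t); lra).
assert (Hs := sqrt_lt_R0 _ Hp).
assert (Hq : sqrt (t ^ 2 + 1) ^ 2 = t ^ 2 + 1) by (apply pow2_sqrt; lra).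
assert (Hd := is_derive_sqrt_sqr_plus_1 t).
pose (q := fun s : R => sqrt (s ^ 2 + 1)).
change (is_derive q t (t / q t)) in Hd; change (0 < q t) in Hs.
change (q t ^ 2 = t ^ 2 + 1) in Hq.
change (is_derive (fun s : R => exp (b * atan s) / q s) t
  ((b - t) / (t ^ 2 + 1) * (exp (b * atan t) / q t))).
clearbody q.
auto_derive; [repeat split; [eexists; exact Hd | lra] |].
rewrite (Derive_eta _ _ _ Hd).
replace (1 + t * (t * 1)) with (t ^ 2 + 1) by ring.
transitivity (b / (t ^ 2 + 1) * exp (b * atan t) / q t
  - exp (b * atan t) * t / q t ^ 2 / q t); [field; lra |].
rewrite Hq; field; lra.
Qed.

(** The function [cl = t / (t^2 + 1)] satisfies [cl' + cl^2 = 1 / (t^2 + 1)^2 = (ck cm)^2], whence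
    the term [w] with coefficient 1 in the reduced equation. *)
Lemma arctan_reduction (nu : R) :
  lie_reduction (fun t => True)
    (fun t => Rpower (t ^ 2 + 1) (3 / 2) * exp (5 * nu * atan t))
    (VectorField (fun t x u => t ^ 2 + 1) (fun t x u => (t + nu) * x)
       (fun t x u => x + (nu - t) * u))
    (fun t x => x * exp (- nu * atan t) / sqrt (t ^ 2 + 1))
    (fun t x v => exp (nu * atan t) / sqrt (t ^ 2 + 1) * v
                  + x * t / (t ^ 2 + 1))
    5 (fun w p => p 5%nat + (p 0%nat - nu * w) * p 1%nat
                  + nu * p 0%nat + w).
Proof.
assert (pos : forall t, 0 < t ^ 2 + 1) by (intros t; generalize (pow2_ge_0 t); lra).
assert (spos : forall t, 0 < sqrt (t ^ 2 + 1))
  by (intros t; apply sqrt_lt_R0, pos).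
assert (sqr : forall t, sqrt (t ^ 2 + 1) ^ 2 = t ^ 2 + 1)
  by (intros t; apply pow2_sqrt, Rlt_le, pos).
pose (c := Coeffs (fun t => exp (- nu * atan t) / sqrt (t ^ 2 + 1)) (fun _ => 0)
  (fun t => exp (nu * atan t) / sqrt (t ^ 2 + 1)) (fun t => t / (t ^ 2 + 1))
  (fun _ => 0)).
pose (d := Coeffs (fun t => (- nu - t) / (t ^ 2 + 1) * cm c t) (fun _ => 0)
  (fun t => (nu - t) / (t ^ 2 + 1) * ck c t)
  (fun t => (1 - t ^ 2) / (t ^ 2 + 1) ^ 2) (fun _ => 0)).
apply (lie_reduction_ext (fun t => True)
  (fun t => Rpower (t ^ 2 + 1) (3 / 2) * exp (5 * nu * atan t)) _
  (affine_field (fun t => t ^ 2 + 1) (fun t => t + nu) (fun _ => 0)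
     (fun t => nu - t) 1 0) _
  (aff_var c) _ (aff_ansatz c) _ 5 (reduced_ode (- nu) 0 nu 1 0));
  try (intros; unfold aff_var, aff_ansatz, reduced_ode; simpl; unfold Rdiv; ring).
apply (affine_lie_reduction _ _ _ _ _ _ _ _ _ _ _ _ _ c d).
- exists 0; exact Logic.I.
- intros t; auto_derive; auto; ring.
- intros t; auto_derive; auto; ring.
- intros t; auto_derive; auto.
- intros t; auto_derive; auto; ring.
- intros t _; assert (Hp := pos t).
  unfold Rpower; auto_derive; [exact Hp |].
  change (t * (t * 1)) with (t ^ 2).
  replace (1 + t ^ 2) with (t ^ 2 + 1) by ring; field; lra.
- intros t _; assert (Hp := pos t); assert (Hs := spos t); unfold c; cbn [cm ck].
  split; [lra |].
  split; apply Rgt_not_eq, Rdiv_lt_0_compat; auto; apply exp_pos.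
- intros t _; assert (Hp := pos t).
  split; [| split; [| split; [| split]]]; cbn [c d cm cn ck cl cr];
    try apply is_derive_exp_atan_div_sqrt; auto_derive; auto; simpl in Hp |- *;
    try lra; field; lra.
- intros t _; assert (Hp := pos t).
  unfold ansatz_compatible; cbn [c d cm cn ck cl cr].
  assert (Hs := spos t).
  repeat split; field; simpl in *; lra.
- intros t _; unfold reduces_to.
  assert (Hp := pos t); assert (Hs := spos t).
  assert (E : ck c t * cm c t = / (t ^ 2 + 1)).
  { cbn [c cm ck].
    transitivity (exp (nu * atan t) * exp (- nu * atan t)
      / sqrt (t ^ 2 + 1) ^ 2); [field; lra |].
    rewrite <- exp_plus.
    replace (nu * atan t + - nu * atan t) with 0 by ring.
    rewrite exp_0, (sqr t); field; lra. }
  rewrite E; cbn [d cm cn ck cl cr].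
  change (cl c t) with (t / (t ^ 2 + 1)); change (cr c t) with 0;
    change (cn c t) with 0.
  repeat split; try (field; lra).
  cbn [c cm ck].
  (* Three of the four roots in [cm^4] cancel against the power 3/2, and [5 nu - 4 nu = nu] in the
     exponent leaves [ck]. *)
  replace (3 / 2) with (1 + / 2) by field.
  rewrite Rpower_plus, Rpower_1, Rpower_sqrt, <- (sqr t) at 1 by exact Hp.
  transitivity (exp (5 * nu * atan t) * exp (- nu * atan t) ^ 4
    / sqrt (t ^ 2 + 1)); [field; lra |].
  replace (exp (- nu * atan t) ^ 4) with
    (exp (- nu * atan t) * exp (- nu * atan t)
     * exp (- nu * atan t) * exp (- nu * atan t)) by ring.
  rewrite <- !exp_plus; do 2 f_equal; ring.
Qed.

(** A uniformly accelerated frame: the derivative of [cr = - e t] is the constant [- e] of the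
    reduced equation. *)
Lemma shifted_galilean_reduction (e : R) :
  e = 1 \/ e = -1 ->
  lie_reduction (fun t => True) (fun t => 1)
    (VectorField (fun t x u => - e) (fun t x u => t) (fun t x u => 1))
    (fun t x => x + e * (t ^ 2 / 2))
    (fun t x v => v - e * t)
    5 (fun w p => p 5%nat + p 0%nat * p 1%nat - e).
Proof.
intros He.
pose (c := Coeffs (fun _ => 1) (fun t => e * (t ^ 2 / 2)) (fun _ => 1)
  (fun _ => 0) (fun t => - e * t)).
pose (d := Coeffs (fun _ => 0) (fun t => e * t) (fun _ => 0) (fun _ => 0)
  (fun _ => - e)).
apply (lie_reduction_ext (fun t => True) (fun _ => 1) _
  (affine_field (fun _ => - e) (fun _ => 0) (fun t => t) (fun _ => 0) 0 1) _
  (aff_var c) _ (aff_ansatz c) _ 5 (reduced_ode 0 0 0 0 (- e)));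
  try (intros; unfold aff_var, aff_ansatz, reduced_ode; simpl; ring).
apply (affine_lie_reduction _ _ _ _ _ _ _ _ _ _ _ _ _ c d).
- exists 0; exact Logic.I.
- intros t; auto_derive; auto; ring.
- intros t; auto_derive; auto.
- intros t; auto_derive; auto.
- intros t; auto_derive; auto; ring.
- intros t _; auto_derive; auto; destruct He; subst e; field.
- intros t _; simpl; repeat split; destruct He; lra.
- intros t _; split; [| split; [| split; [| split]]]; simpl;
    auto_derive; auto; field.
- intros t _; unfold ansatz_compatible; simpl.
  repeat split; destruct He; subst e; ring.
- intros t _; unfold reduces_to; simpl; repeat split; ring.
Qed.

Lemma stationary_reduction :
  lie_reduction (fun t => True) (fun t => 1)
    (VectorField (fun t x u => 1) (fun t x u => 0) (fun t x u => 0))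
    (fun t x => x) (fun t x v => v)
    5 (fun w p => p 5%nat + p 0%nat * p 1%nat).
Proof.
pose (c := Coeffs (fun _ => 1) (fun _ => 0) (fun _ => 1) (fun _ => 0)
  (fun _ => 0)).
pose (d := Coeffs (fun _ => 0) (fun _ => 0) (fun _ => 0) (fun _ => 0)
  (fun _ => 0)).
apply (lie_reduction_ext (fun t => True) (fun _ => 1) _
  (affine_field (fun _ => 1) (fun _ => 0) (fun _ => 0) (fun _ => 0) 0 0) _
  (aff_var c) _ (aff_ansatz c) _ 5 (reduced_ode 0 0 0 0 0));
  try (intros; unfold aff_var, aff_ansatz, reduced_ode; simpl; ring).
apply (affine_lie_reduction _ _ _ _ _ _ _ _ _ _ _ _ _ c d).
- exists 0; exact Logic.I.
- intros t; auto_derive; auto; ring.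
- intros t; auto_derive; auto.
- intros t; auto_derive; auto.
- intros t; auto_derive; auto; ring.
- intros t _; auto_derive; auto; field.
- intros t _; simpl; repeat split; lra.
- intros t _; split; [| split; [| split; [| split]]]; simpl;
    auto_derive; auto.
- intros t _; unfold ansatz_compatible; simpl; repeat split; ring.
- intros t _; unfold reduces_to; simpl; repeat split; ring.
Qed.

Theorem mainTheorem6 :
  (* Case 0 *)
  (forall (beta : R -> R) (a : R),
     lie_reduction (fun t => t + a <> 0) beta
       (VectorField (fun t x u => 0) (fun t x u => t + a) (fun t x u => 1))
       (fun t x => t)
       (fun t x v => v + x / (t + a))
       1 (fun w p => (w + a) * p 1%nat + p 0%nat)) /\
  (* Case 1, rho different from -1 and 4 *)
  (forall rho : R, rho <> -1 -> rho <> 4 ->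
     lie_reduction (fun t => 0 < t) (fun t => Rpower t rho)
       (VectorField (fun t x u => 5 * t) (fun t x u => (rho + 1) * x)
          (fun t x u => (rho - 4) * u))
       (fun t x => x * Rpower t (- ((rho + 1) / 5)))
       (fun t x v => Rpower t ((rho - 4) / 5) * v)
       5 (fun w p => p 5%nat + (p 0%nat - (rho + 1) / 5 * w) * p 1%nat
                     + (rho - 4) / 5 * p 0%nat)) /\
  (* Case 1, rho = -1 *)
  (forall a : R,
     lie_reduction (fun t => 0 < t) (fun t => / t)
       (VectorField (fun t x u => t) (fun t x u => a) (fun t x u => - u))
       (fun t x => x - a * ln t)
       (fun t x v => / t * v)
       5 (fun w p => p 5%nat + (p 0%nat - a) * p 1%nat - p 0%nat)) /\
  (* Case 2 *)
  lie_reduction (fun t => True) (fun t => exp t)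
    (VectorField (fun t x u => 5) (fun t x u => x) (fun t x u => u))
    (fun t x => x * exp (- t / 5))
    (fun t x v => exp (t / 5) * v)
    5 (fun w p => p 5%nat + (p 0%nat - 1 / 5 * w) * p 1%nat
                  + 1 / 5 * p 0%nat) /\
  (* Case 3 *)
  (forall nu : R,
     lie_reduction (fun t => True)
       (fun t => Rpower (t ^ 2 + 1) (3 / 2) * exp (5 * nu * atan t))
       (VectorField (fun t x u => t ^ 2 + 1) (fun t x u => (t + nu) * x)
          (fun t x u => x + (nu - t) * u))
       (fun t x => x * exp (- nu * atan t) / sqrt (t ^ 2 + 1))
       (fun t x v => exp (nu * atan t) / sqrt (t ^ 2 + 1) * v
                     + x * t / (t ^ 2 + 1))
       5 (fun w p => p 5%nat + (p 0%nat - nu * w) * p 1%nat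
                     + nu * p 0%nat + w)) /\
  (* Case 4.1 *)
  lie_reduction (fun t => True) (fun t => 1)
    (VectorField (fun t x u => 1) (fun t x u => 0) (fun t x u => 0))
    (fun t x => x)
    (fun t x v => v)
    5 (fun w p => p 5%nat + p 0%nat * p 1%nat) /\
  (* Case 4.2; e = 1 gives the upper signs, e = -1 the lower ones *)
  (forall e : R, e = 1 \/ e = -1 ->
     lie_reduction (fun t => True) (fun t => 1)
       (VectorField (fun t x u => - e) (fun t x u => t) (fun t x u => 1))
       (fun t x => x + e * (t ^ 2 / 2))
       (fun t x v => v - e * t)
       5 (fun w p => p 5%nat + p 0%nat * p 1%nat - e)).
Proof.
split; [exact galilean_reduction |].
split; [intros rho _ _; exact (power_reduction rho) |].
split; [exact log_reduction |].
split; [exact exp_reduction |].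
split; [exact arctan_reduction |].
split; [exact stationary_reduction | exact shifted_galilean_reduction].
Qed.
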